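(* The class of focus/directrix ellipses in $\mathbb{H}^2$ is not equal to the class of two-focus ellipses in $\mathbb{H}^2$. However, there are curves that are both focus/directrix ellipses and two-focus ellipses. More precisely, every focus/directrix ellipse that is a closed curve in $\mathbb{H}^2$ (i.e. is compact) is also a two-focus ellipse.
   Context: $\mathbb{H}^2$ is the hyperbolic plane (constant curvature $-1$) with Riemannian distance $d$; lines are geodesics. Focus/directrix ellipse: a set $\{x\in\mathbb{H}^2 : \sinh d(x,a_1)=\varepsilon\,\sinh d(x,\ell)\}$, where $a_1\in\mathbb{H}^2$ (the focus), $\ell$ is a line not passing through $a_1$ (the directrix), and $0<\varepsilon<1$ (the eccentricity). Two-focus ellipse: a set $\{x\in\mathbb{H}^2 : d(x,a_1)+d(x,a_2)=c\}$, where $a_1,a_2\in\mathbb{H}^2$ (the foci, possibly equal) and $c$ is a constant with $c>d(a_1,a_2)$. A curve in $\mathbb{H}^2$ is called closed if it is compact. *)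

(* Defs.v *)
From mathcomp Require Import all_boot all_order all_algebra.
From mathcomp Require Import all_classical all_reals all_analysis.
Import Order.TTheory GRing.Theory Num.Theory.
Import numFieldNormedType.Exports.

Local Open Scope classical_set_scope.
Local Open Scope ring_scope.

Definition cosh {R : realType} (x : R) : R := (expR x + expR (- x)) / 2.
Definition sinh {R : realType} (x : R) : R := (expR x - expR (- x)) / 2.

(* Inverse of [cosh] from [1, +oo[ to [0, +oo[; a junk value below 1. *)
Definition arcosh {R : realType} (x : R) : R := ln (x + Num.sqrt (x ^+ 2 - 1)).

Definition lorentz {R : realType} (x y : 'rV[R]_3) : R :=
  - (x 0 0 * y 0 0) + x 0 1 * y 0 1 + x 0 2 * y 0 2.

(* The hyperboloid model of the hyperbolic plane of curvature -1.  Seen as a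
   type, a set carries the subspace topology ([set_type]), which here is the
   manifold topology; the ambient (non-hyperbolic) metric that [set_type] also
   inherits is never used: distances are measured with [hdist]. *)
Definition hyperboloid (R : realType) : set 'rV[R]_3 :=
  [set x | lorentz x x = -1 /\ 0 < x 0 0].

Definition H2 (R : realType) : topologicalType := set_type (hyperboloid R).

Section HyperbolicPlane.
Context {R : realType}.
Implicit Types (a x y : H2 R) (l : set (H2 R)) (c eps : R).

(* The Riemannian distance of the metric induced by [lorentz] on the
   hyperboloid, given by cosh d(x, y) = - <x, y>; on the hyperboloid
   - <x, y> >= 1. *)
Definition hdist x y : R := arcosh (- lorentz (set_val x) (set_val y)).

(* Complete geodesics, parametrized by arc length; in the hyperbolic plane
   every geodesic is globally minimizing. *)
Definition is_line l : Prop :=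
  exists gamma : R -> H2 R,
    (forall s t, hdist (gamma s) (gamma t) = `|s - t|) /\ l = range gamma.

Definition hdist_set x l : R := inf [set hdist x y | y in l].

Definition focus_directrix_locus a l eps : set (H2 R) :=
  [set x | sinh (hdist x a) = eps * sinh (hdist_set x l)].

Definition two_focus_locus a1 a2 c : set (H2 R) :=
  [set x | hdist x a1 + hdist x a2 = c].

End HyperbolicPlane.

Definition focus_directrix_ellipses (R : realType) : set (set (H2 R)) :=
  [set E | exists a l eps,
    [/\ is_line l, ~ l a, 0 < eps < 1 & E = focus_directrix_locus a l eps]].

Definition two_focus_ellipses (R : realType) : set (set (H2 R)) :=
  [set E | exists a1 a2 c,
    hdist a1 a2 < c /\ E = two_focus_locus a1 a2 c].

(* Main.v *)
(* In the hyperboloid model a line is the trace of n^perp for a unit spacelike n,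
   and sinh d(x, l) = |<n, x>|, so the focus/directrix locus is the quadric
   <x, a>^2 - 1 = eps^2 <n, x>^2, whereas the two-focus locus is the quadric
   u^2 + v^2 - 2 C u v = 1 - C^2 with u = <x, f1>, v = <x, f2>, C = cosh c.
   Let h = sinh d(a, l), so that cosh d(a, l) = sqrt (1 + h^2).  If
   eps (h + sqrt (1 + h^2)) < 1, diagonalizing the first quadratic form against
   the Lorentz form in the plane spanned by a and n yields the two foci.
   Otherwise the locus is unbounded, hence not compact and not a two-focus
   ellipse. *)
Require Import Defs.
From mathcomp Require Import all_boot all_order all_algebra.
From mathcomp Require Import all_classical all_reals all_analysis.
From mathcomp Require Import ring lra.
Import Order.TTheory GRing.Theory Num.Theory.
Import numFieldNormedType.Exports.

Local Open Scope classical_set_scope.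
Local Open Scope ring_scope.

(** * Hyperbolic functions and [arcosh] *)

Section HyperbolicFunctions.
Context {R : realType}.
Implicit Types x y v : R.

Lemma cosh2B_sinh2 x : cosh x ^+ 2 - sinh x ^+ 2 = 1.
Proof. by rewrite /cosh /sinh; have := expRxMexpNx_1 x; lra. Qed.

Lemma coshN x : cosh (- x) = cosh x.
Proof. by rewrite /cosh opprK addrC. Qed.

Lemma sinhN x : sinh (- x) = - sinh x.
Proof. by rewrite /sinh opprK -mulNr opprB. Qed.

Lemma coshD x y : cosh (x + y) = cosh x * cosh y + sinh x * sinh y.
Proof. by rewrite /cosh /sinh opprD !expRD; field. Qed.

Lemma coshB x y : cosh (x - y) = cosh x * cosh y - sinh x * sinh y.
Proof. by rewrite coshD coshN sinhN mulrN. Qed.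

Lemma cosh_abs x : cosh `|x| = cosh x.
Proof. by case: (ger0P x) => _ //; rewrite coshN. Qed.

Lemma sinh_ge0 x : 0 <= x -> 0 <= sinh x.
Proof. by move=> x0; rewrite /sinh divr_ge0 // subr_ge0 ler_expR; lra. Qed.

Lemma sinh_gt0 x : 0 < x -> 0 < sinh x.
Proof. by move=> x0; rewrite /sinh divr_gt0 // subr_gt0 ltr_expR; lra. Qed.

Lemma cosh_ge1 x : 1 <= cosh x.
Proof.
have e0 := expR_gt0 x; have e1 := expR_gt0 (- x).
have s2 := sqr_ge0 (sinh x); have := cosh2B_sinh2 x.
have c0 : 0 < cosh x by rewrite /cosh; lra.
by move=> e; rewrite leNgt; apply/negP => c1; nra.
Qed.

Lemma ltr_cosh x y : 0 <= x -> x < y -> cosh x < cosh y.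
Proof.
move=> x0 xy; rewrite -(subrK x y) coshD.
have sx := sinh_ge0 x x0.
have sd : 0 < sinh (y - x) by apply: sinh_gt0; lra.
have cx := cosh_ge1 x; have cd := cosh_ge1 (y - x).
have e := cosh2B_sinh2 (y - x).
have cd1 : 1 < cosh (y - x) by rewrite ltNge; apply/negP => c1; nra.
nra.
Qed.

Lemma ler_cosh x y : 0 <= x -> x <= y -> cosh x <= cosh y.
Proof.
move=> x0; rewrite le_eqVlt => /predU1P[->//|xy].
by apply: ltW; apply: ltr_cosh.
Qed.

Lemma cosh_inj x y : 0 <= x -> 0 <= y -> cosh x = cosh y -> x = y.
Proof.
move=> x0 y0 e; apply/eqP; rewrite eq_le !leNgt; apply/andP; split.
  by apply/negP => /(ltr_cosh _ _ y0); rewrite e ltxx.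
by apply/negP => /(ltr_cosh _ _ x0); rewrite e ltxx.
Qed.

Lemma arcosh_ge0 v : 1 <= v -> 0 <= arcosh v.
Proof. by move=> v1; rewrite ln_ge0 //; have := sqrtr_ge0 (v ^+ 2 - 1); lra. Qed.

Lemma arcoshK v : 1 <= v -> cosh (arcosh v) = v.
Proof.
move=> v1; have s0 := sqrtr_ge0 (v ^+ 2 - 1).
have s2 : Num.sqrt (v ^+ 2 - 1) ^+ 2 = v ^+ 2 - 1 by rewrite sqr_sqrtr; nra.
rewrite /cosh /arcosh expRN; set s := Num.sqrt _ in s0 s2 *.
have p : 0 < v + s by lra.
rewrite lnK ?posrE //.
(* The product [(v + s) (v - s)] is [v^2 - s^2 = 1]. *)
have -> : (v + s)^-1 = v - s.
  by apply: (mulfI (lt0r_neq0 p)); rewrite mulfV ?lt0r_neq0 //; nra.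
lra.
Qed.

Lemma coshK x : arcosh (cosh x) = `|x|.
Proof.
apply: cosh_inj => //; first by rewrite arcosh_ge0 ?cosh_ge1.
by rewrite arcoshK ?cosh_ge1 // cosh_abs.
Qed.

Lemma sinh_arcosh v : 1 <= v -> sinh (arcosh v) = Num.sqrt (v ^+ 2 - 1).
Proof.
move=> v1; have s0 : 0 <= sinh (arcosh v) by rewrite sinh_ge0 ?arcosh_ge0.
have := cosh2B_sinh2 (arcosh v); rewrite arcoshK // => e.
by rewrite -[LHS](ger0_norm s0) -sqrtr_sqr; congr Num.sqrt; lra.
Qed.

End HyperbolicFunctions.

(** * The Lorentz form and its cross product *)

Section LorentzForm.
Context {R : realType}.
Implicit Types x y z : 'rV[R]_3.

Lemma lorentzC x y : lorentz x y = lorentz y x.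
Proof. by rewrite /lorentz; ring. Qed.

Lemma lorentzDl x y z : lorentz (x + y) z = lorentz x z + lorentz y z.
Proof. by rewrite /lorentz !mxE; ring. Qed.

Lemma lorentzZl c x z : lorentz (c *: x) z = c * lorentz x z.
Proof. by rewrite /lorentz !mxE; ring. Qed.

Lemma lorentzDr x y z : lorentz z (x + y) = lorentz z x + lorentz z y.
Proof. by rewrite lorentzC lorentzDl !(lorentzC z). Qed.

Lemma lorentzZr c x z : lorentz z (c *: x) = c * lorentz z x.
Proof. by rewrite lorentzC lorentzZl lorentzC. Qed.

Definition lorentzE := (lorentzDl, lorentzDr, lorentzZl, lorentzZr).

Lemma continuous_lorentz x : continuous (lorentz x).
Proof.
have -> : lorentz x = (fun y => (- x 0 0) * y 0 0 + x 0 1 * y 0 1 + x 0 2 * y 0 2).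
  by apply/funext => y; rewrite /lorentz mulNr.
move=> y.
have h c (i : 'I_3) : (fun z : 'rV[R]_3 => c * z 0 i) z @[z --> y] --> c * y 0 i.
  exact: cvgM (cvg_cst c) (@coord_continuous _ _ _ 0 i y).
exact: cvgD (cvgD (h _ 0) (h _ 1)) (h _ 2).
Qed.

(* The Lorentzian cross product: <cross x y, z> = det (x, y, z). *)
Definition cross (x y : 'rV[R]_3) : 'rV[R]_3 :=
  \row_j (if j == 0 then x 0 2 * y 0 1 - x 0 1 * y 0 2
          else if j == 1 then x 0 2 * y 0 0 - x 0 0 * y 0 2
          else x 0 0 * y 0 1 - x 0 1 * y 0 0).

Lemma lorentz_crossl x y : lorentz (cross x y) x = 0.
Proof. by rewrite /lorentz /cross !mxE /=; ring. Qed.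

Lemma lorentz_crossr x y : lorentz (cross x y) y = 0.
Proof. by rewrite /lorentz /cross !mxE /=; ring. Qed.

Lemma lorentz_cross x y :
  lorentz (cross x y) (cross x y) =
  lorentz x y ^+ 2 - lorentz x x * lorentz y y.
Proof. by rewrite /lorentz /cross !mxE /=; ring. Qed.

(* Gram determinant of x, y, z, up to sign. *)
Lemma lorentz_gram x y z :
  lorentz (cross x y) z ^+ 2 =
  lorentz x y ^+ 2 * lorentz z z + lorentz y z ^+ 2 * lorentz x x
  + lorentz x z ^+ 2 * lorentz y y - lorentz x x * lorentz y y * lorentz z z
  - 2 * lorentz x y * lorentz y z * lorentz x z.
Proof. by rewrite /lorentz /cross !mxE /=; ring. Qed.

(** Reversed Cauchy-Schwarz inequality. It follows from Lagrange's identity for [(1, b, c)] and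
    [(1, e, f)], the first coordinates [a], [d] being the Euclidean norms of these vectors. *)
Lemma hyperboloid_ge1 x y :
  hyperboloid R x -> hyperboloid R y -> 1 <= - lorentz x y.
Proof.
case=> xx x0 [yy y0]; move: xx yy; rewrite /lorentz.
move: (x 0 0) (x 0 1) (x 0 2) (y 0 0) (y 0 1) (y 0 2) x0 y0.
move=> a b c d e f a0 d0 xx yy.
have : (1 + (b * e + c * f)) ^+ 2 <= (a * d) ^+ 2.
  have -> : (a * d) ^+ 2 = (1 + b ^+ 2 + c ^+ 2) * (1 + e ^+ 2 + f ^+ 2).
    by rewrite exprMn; congr (_ * _); lra.
  have := sqr_ge0 (b - e); have := sqr_ge0 (c - f).
  have := sqr_ge0 (b * f - c * e); lra.
have ad : 0 < a * d by rewrite mulr_gt0.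
move=> h; suff : 1 + (b * e + c * f) <= a * d by lra.
by rewrite leNgt; apply/negP => h'; nra.
Qed.

(** Selects the sheet without computing a first coordinate: were [x] on the lower sheet,
    [hyperboloid_ge1] for [- x] and [a] would contradict the sign of the product. *)
Lemma hyperboloidP x a :
  hyperboloid R a -> lorentz x x = -1 -> 0 < - lorentz x a -> hyperboloid R x.
Proof.
move=> ha xx xa; split => //; rewrite ltNge; apply/negP => x0.
have xneq0 : x 0 0 != 0.
  apply/eqP => e; move: xx; rewrite /lorentz e.
  have := sqr_ge0 (x 0 1); have := sqr_ge0 (x 0 2); lra.
have hx : hyperboloid R (-1 *: x).
  split; first by rewrite !lorentzE; lra.
  by rewrite mxE mulN1r oppr_gt0 lt_neqAle xneq0.
by have := hyperboloid_ge1 _ _ hx ha; rewrite !lorentzE; lra.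
Qed.

End LorentzForm.

(** * Distances, lines and both loci as Lorentz quadrics *)

Section HyperbolicPlane.
Context {R : realType}.
Implicit Types (x y z a : H2 R) (l : set (H2 R)) (n v w : 'rV[R]_3).

Definition mkH2 v (hv : hyperboloid R v) : H2 R := exist _ v (mem_set hv).

Lemma H2P x : hyperboloid R (set_val x).
Proof. exact: set_valP. Qed.

Lemma lorentzxx x : lorentz (set_val x) (set_val x) = -1.
Proof. by case: (H2P x). Qed.

Lemma hdist_ge0 x y : 0 <= hdist x y.
Proof. by rewrite arcosh_ge0 // hyperboloid_ge1 //; apply: H2P. Qed.

Lemma cosh_hdist x y : cosh (hdist x y) = - lorentz (set_val x) (set_val y).
Proof. by rewrite arcoshK // hyperboloid_ge1 //; apply: H2P. Qed.

Lemma sinh_hdist x y :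
  sinh (hdist x y) = Num.sqrt (lorentz (set_val x) (set_val y) ^+ 2 - 1).
Proof. by rewrite sinh_arcosh ?sqrrN // hyperboloid_ge1 //; apply: H2P. Qed.

(* The triangle inequality, read off the sign of the Gram determinant. *)
Lemma cosh_hdistB x y z : cosh (hdist x y - hdist x z) <= cosh (hdist y z).
Proof.
have g := sqr_ge0 (lorentz (cross (set_val x) (set_val y)) (set_val z)).
rewrite lorentz_gram !lorentzxx in g.
have eyz := cosh_hdist y z; have exy := cosh_hdist x y.
have exz := cosh_hdist x z.
have sxy := sinh_ge0 _ (hdist_ge0 x y); have sxz := sinh_ge0 _ (hdist_ge0 x z).
have hxy := cosh2B_sinh2 (hdist x y); have hxz := cosh2B_sinh2 (hdist x z).
rewrite coshB; rewrite exy exz eyz in hxy hxz *.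
move: (lorentz _ _) (lorentz _ _) (lorentz _ _) (sinh _) (sinh _)
  g hxy hxz sxy sxz {exy exz eyz} => u w v s t g hu hv s0 t0.
have e : (s * t) ^+ 2 = (u ^+ 2 - 1) * (v ^+ 2 - 1).
  by rewrite exprMn; congr (_ * _); lra.
have st0 : 0 <= s * t by rewrite mulr_ge0.
by rewrite leNgt; apply/negP => h; nra.
Qed.

(** Coordinates of [u] in the basis [v], [w], [cross v w], with the denominator cleared. It serves
    to show that a vector orthogonal to all three vanishes. *)
Lemma cross_expansion v w u :
  lorentz (cross v w) (cross v w) *: u =
  lorentz u (cross v w) *: cross v w
  + (lorentz u w * lorentz v w - lorentz u v * lorentz w w) *: v
  + (lorentz u v * lorentz v w - lorentz u w * lorentz v v) *: w.
Proof.
apply/rowP => j; have : [\/ j = 0, j = 1 | j = 2].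
  by case: j => [[|[|[|//]]] ?]; [constructor 1 | constructor 2 | constructor 3];
    apply: val_inj.
by rewrite /lorentz /cross !mxE /= => -[] -> /=; ring.
Qed.

(** The normal is the cross product of the points at parameters 0 and 1, divided by [sinh 1]. A
    point is orthogonal to it when its Gram determinant with these two points is zero, and this is a
    condition on distances, which is all that is known of [gamma]. *)
Lemma line_normal l : is_line l ->
  exists n, lorentz n n = 1 /\ forall x, l x <-> lorentz n (set_val x) = 0.
Proof.
case=> gamma [iso ->].
have cosh_gamma s t :
    lorentz (set_val (gamma s)) (set_val (gamma t)) = - cosh (s - t).
  by rewrite -cosh_abs -iso cosh_hdist opprK.
set p := set_val (gamma 0); set q := set_val (gamma 1).
have pp : lorentz p p = -1 by apply: lorentzxx.
have qq : lorentz q q = -1 by apply: lorentzxx.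
have pq : lorentz p q = - cosh 1 by rewrite cosh_gamma sub0r coshN.
have s1 : 0 < sinh (1 : R) by apply: sinh_gt0; lra.
have hyp1 := cosh2B_sinh2 (1 : R).
have cc : lorentz (cross p q) (cross p q) = sinh 1 ^+ 2.
  by rewrite lorentz_cross pp qq pq; lra.
have gammac s : lorentz (cross p q) (set_val (gamma s)) = 0.
  apply/eqP; rewrite -sqrf_eq0 lorentz_gram pp qq pq lorentzxx !cosh_gamma.
  rewrite sub0r coshN -(opprB s 1) coshN coshB.
  have hyps := cosh2B_sinh2 s; apply/eqP.
  have : (sinh s * sinh 1) ^+ 2 = (cosh s ^+ 2 - 1) * (cosh 1 ^+ 2 - 1).
    by rewrite exprMn; congr (_ * _); lra.
  lra.
exists ((sinh 1)^-1 *: cross p q); split.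
  by rewrite !lorentzE cc; field; rewrite lt0r_neq0.
move=> x; rewrite lorentzZl; split; first by case=> s _ <-; rewrite gammac mulr0.
move=> /eqP; rewrite mulf_eq0 invr_eq0 gt_eqF //= => /eqP xc.
have : lorentz (cross p q) (set_val x) ^+ 2 = 0 by rewrite xc expr0n.
rewrite lorentz_gram pp qq pq lorentzxx.
have := cosh_hdist x (gamma 0); rewrite -/p lorentzC => px.
have := cosh2B_sinh2 (hdist x (gamma 0)); rewrite px sqrrN => hypx g.
(* The vanishing Gram determinant is a quadratic equation in [<q, x>]. Its two roots are the values
   at [gamma d] and [gamma (- d)], with [d] the distance from [x] to [gamma 0]. *)
have qx : lorentz q (set_val x) = - cosh (hdist x (gamma 0) - 1) \/
    lorentz q (set_val x) = - cosh (- hdist x (gamma 0) - 1).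
  rewrite -[in X in _ \/ X]opprD coshN coshB coshD px.
  move: g hypx; move: (lorentz p _) (lorentz q _) (sinh (hdist _ _)) => u v s g hs.
  have : (s * sinh 1) ^+ 2 = (u ^+ 2 - 1) * (cosh 1 ^+ 2 - 1).
    by rewrite exprMn; congr (_ * _); lra.
  move=> e; have : (v - u * cosh 1 - s * sinh 1) * (v - u * cosh 1 + s * sinh 1) = 0.
    lra.
  by move=> /eqP; rewrite mulf_eq0 => /orP[] /eqP h; [left | right]; lra.
have [s [ps qs]] : exists s, lorentz p (set_val x) = - cosh s /\
    lorentz q (set_val x) = - cosh (s - 1).
  case: qx => qx; [exists (hdist x (gamma 0)) | exists (- hdist x (gamma 0))].
    by rewrite qx px opprK.
  by rewrite qx coshN px opprK.
exists s => //; apply: val_inj; apply/eqP; rewrite -subr_eq0 -scaleN1r; apply/eqP.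
(* [gamma s - x] is orthogonal to [p], [q] and [cross p q], hence zero. *)
have := cross_expansion p q (set_val (gamma s) + (-1) *: set_val x).
have -> : lorentz (set_val (gamma s) + -1 *: set_val x) p = 0.
  by rewrite !lorentzE cosh_gamma subr0 (lorentzC _ p) ps; lra.
have -> : lorentz (set_val (gamma s) + -1 *: set_val x) q = 0.
  by rewrite !lorentzE cosh_gamma (lorentzC _ q) qs; lra.
have -> : lorentz (set_val (gamma s) + -1 *: set_val x) (cross p q) = 0.
  by rewrite !lorentzE !(lorentzC _ (cross p q)) gammac xc; lra.
rewrite !mul0r !subr0 !scale0r !addr0 cc => /eqP.
by rewrite scaler_eq0 sqrf_eq0 gt_eqF //= => /eqP.
Qed.

(** Since [x = r v + N n] with [v] on the line, every [y] on the line satisfies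
    [cosh d(x, y) = r cosh d(v, y) >= r]. The infimum is thus attained at [v], where [cosh d = r]
    and [sinh d = |N|]. *)
Lemma sinh_hdist_set l n x :
    lorentz n n = 1 -> (forall y, l y <-> lorentz n (set_val y) = 0) ->
  sinh (hdist_set x l) = `|lorentz n (set_val x)|.
Proof.
move=> nn hl; set N := lorentz n (set_val x).
pose r := Num.sqrt (1 + N ^+ 2).
have r2 : r ^+ 2 = 1 + N ^+ 2 by rewrite sqr_sqrtr; have := sqr_ge0 N; lra.
have r0 : 0 < r by rewrite sqrtr_gt0; have := sqr_ge0 N; lra.
have rn0 := lt0r_neq0 r0.
(* v is the foot of the perpendicular from x to l. *)
pose v := r^-1 *: (set_val x + (- N) *: n).
have vx : lorentz v (set_val x) = - r.
  rewrite /v !lorentzE lorentzxx -/N.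
  by apply: (mulfI rn0); rewrite mulrA mulfV // mulrN -expr2 r2; lra.
have hv : hyperboloid R v.
  apply: hyperboloidP (H2P x) _ _; last by rewrite vx opprK.
  rewrite /v !lorentzE lorentzxx nn (lorentzC _ n) -/N.
  apply: (mulfI rn0); apply: (mulfI rn0).
  by rewrite mulr1 subrr !mulr0 addr0 !mulVKf //; lra.
have lv : l (mkH2 v hv).
  by apply/hl; rewrite /= /v !lorentzE nn -/N; lra.
have xE : set_val x = r *: v + N *: n.
  by rewrite /v scalerA mulfV // scale1r -addrA -scalerDl addNr scale0r addr0.
clearbody v; have le_hdist y : l y -> hdist x (mkH2 v hv) <= hdist x y.
  move=> /hl ly; rewrite leNgt; apply/negP => /(ltr_cosh _ _ (hdist_ge0 _ _)).
  rewrite !cosh_hdist /= (lorentzC _ v) vx opprK xE !lorentzE ly.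
  by have := hyperboloid_ge1 _ _ hv (H2P y); nra.
have -> : hdist_set x l = hdist x (mkH2 v hv).
  apply/eqP; rewrite eq_le; apply/andP; split.
    apply: ge_inf; last by exists (mkH2 v hv).
    by exists 0 => _ [y _ <-]; apply: hdist_ge0.
  apply: lb_le_inf; first by exists (hdist x (mkH2 v hv)), (mkH2 v hv).
  by move=> _ [y /le_hdist ? <-].
by rewrite sinh_hdist /= lorentzC vx sqrrN r2 addrC addKr sqrtr_sqr.
Qed.

(** Both sides of the defining equation are nonnegative, so squaring it is reversible. *)
Lemma focus_directrix_locusE a l n eps x :
    lorentz n n = 1 -> (forall y, l y <-> lorentz n (set_val y) = 0) -> 0 < eps ->
  focus_directrix_locus a l eps x <->
  lorentz (set_val x) (set_val a) ^+ 2 - 1 = (eps * lorentz n (set_val x)) ^+ 2.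
Proof.
move=> nn hl eps0; rewrite /focus_directrix_locus /= (sinh_hdist_set l n) //.
have p := mulr_ge0 (ltW eps0) (normr_ge0 (lorentz n (set_val x))).
have s := sinh_ge0 _ (hdist_ge0 x a).
have := cosh2B_sinh2 (hdist x a); rewrite cosh_hdist sqrrN => e.
have -> : lorentz (set_val x) (set_val a) ^+ 2 - 1 = sinh (hdist x a) ^+ 2 by lra.
have -> : (eps * lorentz n (set_val x)) ^+ 2 =
    (eps * `|lorentz n (set_val x)|) ^+ 2 by rewrite !exprMn real_normK ?num_real.
split=> [-> //|h]; apply/eqP.
by rewrite -(@eqrXn2 _ 2) //; apply/eqP.
Qed.

(** Squaring the addition formula for [cosh] removes the [sinh] factors but adds the branch
    [cosh c = cosh (d(x, f1) - d(x, f2))]. The triangle inequality and [hdist f1 f2 < c] exclude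
    that branch. *)
Lemma two_focus_locusE f1 f2 c x : hdist f1 f2 < c ->
  two_focus_locus f1 f2 c x <->
  lorentz (set_val x) (set_val f1) ^+ 2 + lorentz (set_val x) (set_val f2) ^+ 2
  - 2 * cosh c * lorentz (set_val x) (set_val f1)
        * lorentz (set_val x) (set_val f2)
  = 1 - cosh c ^+ 2.
Proof.
move=> fc; have c0 : 0 <= c by have := hdist_ge0 f1 f2; lra.
have s0 : 0 <= sinh (hdist x f1) * sinh (hdist x f2).
  by rewrite mulr_ge0 // sinh_ge0 ?hdist_ge0.
have eD := coshD (hdist x f1) (hdist x f2).
have eB := coshB (hdist x f1) (hdist x f2).
have := cosh2B_sinh2 (hdist x f1); have := cosh2B_sinh2 (hdist x f2).
have := cosh_hdistB x f1 f2; have := ltr_cosh _ _ (hdist_ge0 _ _) fc.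
rewrite /two_focus_locus /= {}eB; move: eD; rewrite !(cosh_hdist x).
set u := lorentz _ (set_val f1); set v := lorentz _ (set_val f2).
move: (sinh (hdist x f1)) (sinh (hdist x f2)) s0 => s t s0 eD dc dB hv hu.
have st : (s * t) ^+ 2 = (u ^+ 2 - 1) * (v ^+ 2 - 1).
  by rewrite exprMn; congr (_ * _); lra.
split=> [e|e].
  by move: eD; rewrite e => ->; lra.
have : (cosh c - u * v - s * t) * (cosh c - u * v + s * t) = 0 by lra.
move=> /eqP; rewrite mulf_eq0 => /orP[] /eqP h; last by lra.
by apply: cosh_inj; rewrite ?addr_ge0 ?hdist_ge0 // eD; lra.
Qed.

Lemma two_focus_locus_bounded a f1 f2 c : exists K, forall x,
  two_focus_locus f1 f2 c x -> - lorentz (set_val x) (set_val a) <= K.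
Proof.
exists (cosh (c + hdist a f1)) => x; rewrite /two_focus_locus /= -cosh_hdist => xc.
apply: ler_cosh; first exact: hdist_ge0.
have := hdist_ge0 x f2; suff : hdist x a - hdist x f1 <= hdist a f1 by lra.
rewrite leNgt; apply/negP => /(ltr_cosh _ _ (hdist_ge0 _ _)).
by rewrite ltNge cosh_hdistB.
Qed.

Lemma line_normal_off l a : is_line l -> ~ l a ->
  exists n, [/\ lorentz n n = 1, forall x, l x <-> lorentz n (set_val x) = 0
              & 0 < lorentz n (set_val a)].
Proof.
move=> /line_normal[n [nn hl]] la.
have na : lorentz n (set_val a) != 0 by apply/eqP => /hl.
case: (ltrP 0 (lorentz n (set_val a))) => na0; first by exists n.
exists (- 1 *: n); split; first by rewrite !lorentzE nn; lra.
  by move=> x; rewrite lorentzZl; split=> [/hl -> | /eqP h]; [lra | apply/hl; lra].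
by rewrite lorentzZl mulN1r oppr_gt0 lt_neqAle na.
Qed.

End HyperbolicPlane.

(** * The conic in coordinates: foci and unboundedness *)

Section PlaneConic.
Context {R : realType}.
Implicit Types g k e t y : R.

(* In the plane of a and n, with t = - <x, a> and y the coordinate orthogonal to
   a, the focus/directrix locus is t^2 - (g t + k y)^2 = 1 for g = eps h and
   k = eps sqrt (1 + h^2), and the foci are P a + S b and P' a + S' b. *)
Lemma conic_foci g k e : 0 < g -> 0 < k -> 0 < e -> k ^+ 2 - g ^+ 2 = e ^+ 2 ->
    g + k < 1 ->
  exists P S P' S' C : R, [/\ 0 < P /\ 0 < P', P ^+ 2 - S ^+ 2 = 1 /\
    P' ^+ 2 - S' ^+ 2 = 1, P * P' - S * S' < C, 1 < C &
    forall t y, (P * t - S * y) ^+ 2 + (P' * t - S' * y) ^+ 2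
      - 2 * C * (P * t - S * y) * (P' * t - S' * y) - (1 - C ^+ 2) =
      (C ^+ 2 - 1) * (1 - t ^+ 2 + (g * t + k * y) ^+ 2)].
Proof.
move=> g0 k0 e0 kge gk1.
have ek : e < k by rewrite ltNge; apply/negP => h; nra.
(* - A and - B are the eigenvalues, relative to the Lorentz form, of the form
   t^2 - (g t + k y)^2 = A T^2 - B Y^2, where T = mu t - nu y, Y = mu y - nu t;
   W = cosh (c / 2)^2, while cd and sd are cosh and sinh of half the focal
   distance. *)
pose D := (1 - k - g) * (1 - k + g) * (1 + k - g) * (1 + k + g).
(* [D] is the discriminant of [X^2 - (1 + e^2) X + k^2], whose roots are [A] and [B]. Its first
   factor is positive because [g + k < 1]. *)
have D0 : 0 < D by rewrite !mulr_gt0 //; lra.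
pose M := Num.sqrt D; have M0 : 0 < M by rewrite sqrtr_gt0.
have M2 : M ^+ 2 = D by rewrite sqr_sqrtr ?ltW.
have Me : M ^+ 2 = (1 + e ^+ 2) ^+ 2 - 4 * k ^+ 2 by rewrite M2 /D -kge; ring.
have Mg : M ^+ 2 + 4 * (g * k) ^+ 2 = (1 - g ^+ 2 - k ^+ 2) ^+ 2.
  by rewrite M2 /D; ring.
clearbody M; clear D D0 M2.
have e1 : e < 1 by lra.
(* This amounts to [A < 1]. It holds because [e < k]: replacing [k] by [e] in [Me] would give
   [(1 - e^2)^2]. *)
have Mlt : M < 1 - e ^+ 2.
  have p : 0 < 1 - e ^+ 2 by nra.
  by rewrite ltNge; apply/negP => h; nra.
pose A := (1 + e ^+ 2 + M) / 2; pose B := (1 + e ^+ 2 - M) / 2.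
have A0 : 0 < A by rewrite /A; nra.
have A1 : A < 1 by rewrite /A; lra.
have B0 : 0 < B by rewrite /B; nra.
have BA : B < A by rewrite /A /B; lra.
have ABM : A - B = M by rewrite /A /B; lra.
have ABe : A + B = 1 + e ^+ 2 by rewrite /A /B; lra.
clearbody A B.
(* The solution of [A W - B (W - 1) = 1], that is, of [cd^2 - sd^2 = 1]. *)
pose W := (1 - B) / M.
have WM : W * M = 1 - B by rewrite /W divfK ?gt_eqF.
have WM1 : (W - 1) * M = 1 - A by rewrite mulrBl WM; lra.
have W1 : 0 < W - 1 by rewrite -(pmulr_lgt0 _ M0) WM1; lra.
clearbody W.
(* [Q] is [cosh] of twice the rapidity of the diagonalizing boost; the half-angle formulas then give
   [mu] and [nu] as its [cosh] and [sinh]. *)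
pose Q := (1 - g ^+ 2 - k ^+ 2) / M.
have QM : Q * M = 1 - g ^+ 2 - k ^+ 2 by rewrite /Q divfK ?gt_eqF.
have q0 : 0 < 1 - g ^+ 2 - k ^+ 2 by nra.
have Q1 : 1 < Q.
  rewrite -(ltr_pM2r M0) QM mul1r ltNge; apply/negP => h.
  have : 0 < (g * k) ^+ 2 by rewrite exprn_gt0 // mulr_gt0.
  nra.
clearbody Q.
pose mu := Num.sqrt ((Q + 1) / 2); pose nu := Num.sqrt ((Q - 1) / 2).
have mu2 : mu ^+ 2 = (Q + 1) / 2 by rewrite sqr_sqrtr //; lra.
have nu2 : nu ^+ 2 = (Q - 1) / 2 by rewrite sqr_sqrtr //; lra.
have mu0 : 0 < mu by rewrite sqrtr_gt0; lra.
have nu0 : 0 < nu by rewrite sqrtr_gt0; lra.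
have munu : M * (mu * nu) = g * k.
  apply/eqP; rewrite -(@eqrXn2 _ 2) ?mulr_ge0 ?ltW // !exprMn mu2 nu2; apply/eqP.
  have : (Q * M) ^+ 2 = (1 - g ^+ 2 - k ^+ 2) ^+ 2 by rewrite QM.
  by rewrite exprMn; lra.
(* These values come from comparing the coefficients of [T^2] and [Y^2] in the two quadrics, with
   [C^2 - 1 = 4 W (W - 1)]. *)
pose cd := Num.sqrt (A * W); pose sd := Num.sqrt (B * (W - 1)).
have W0 : 0 < W by lra.
have cd0 : 0 < cd by rewrite sqrtr_gt0 mulr_gt0.
have sd0 : 0 < sd by rewrite sqrtr_gt0 mulr_gt0.
have cd2 : cd ^+ 2 = A * W by rewrite sqr_sqrtr // ltW // mulr_gt0.
have sd2 : sd ^+ 2 = B * (W - 1) by rewrite sqr_sqrtr // ltW // mulr_gt0.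
clearbody mu nu cd sd.
have cdsd : cd ^+ 2 - sd ^+ 2 = 1.
  rewrite cd2 sd2; apply: (mulfI (lt0r_neq0 M0)).
  transitivity (A * (W * M) - B * ((W - 1) * M)); first by ring.
  by rewrite WM WM1; lra.
have munu1 : mu ^+ 2 - nu ^+ 2 = 1 by lra.
have ctt : A * mu ^+ 2 - B * nu ^+ 2 = 1 - g ^+ 2.
  rewrite mu2 nu2; have : Q * (A - B) = 1 - g ^+ 2 - k ^+ 2 by rewrite ABM.
  lra.
have cyy : A * nu ^+ 2 - B * mu ^+ 2 = - k ^+ 2.
  rewrite mu2 nu2; have : Q * (A - B) = 1 - g ^+ 2 - k ^+ 2 by rewrite ABM.
  lra.
have cty : A * (mu * nu) - B * (mu * nu) = g * k by rewrite -munu -ABM; ring.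
have cs : sd < cd by rewrite ltNge; apply/negP => h; nra.
have mn : nu < mu by rewrite ltNge; apply/negP => h; nra.
have sn : sd * nu < cd * mu by apply: ltr_pM => //; apply: ltW.
(* The foci are [cd (mu a + nu b) + sd (nu a + mu b)] and the same with [- sd]: they lie
   symmetrically about the centre [mu a + nu b]. The value of [C] is the double-angle formula for
   [cosh c]. *)
exists (cd * mu + sd * nu), (cd * nu + sd * mu),
  (cd * mu - sd * nu), (cd * nu - sd * mu), (2 * W - 1); split.
- by split; [apply: addr_gt0; apply: mulr_gt0 | lra].
- split.
    transitivity ((cd ^+ 2 - sd ^+ 2) * (mu ^+ 2 - nu ^+ 2)); first by ring.
    by rewrite cdsd munu1 mulr1.
  transitivity ((cd ^+ 2 - sd ^+ 2) * (mu ^+ 2 - nu ^+ 2)); first by ring.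
  by rewrite cdsd munu1 mulr1.
- have -> : (cd * mu + sd * nu) * (cd * mu - sd * nu)
      - (cd * nu + sd * mu) * (cd * nu - sd * mu) =
      (cd ^+ 2 + sd ^+ 2) * (mu ^+ 2 - nu ^+ 2) by ring.
  rewrite munu1 mulr1; have : cd ^+ 2 < W by rewrite cd2; nra.
  lra.
- lra.
- move=> t y.
  pose T := mu * t - nu * y; pose Y := mu * y - nu * t.
  transitivity (2 * cd ^+ 2 * (2 - 2 * W) * T ^+ 2 + 4 * sd ^+ 2 * W * Y ^+ 2
      - (1 - (2 * W - 1) ^+ 2)); first by rewrite /T /Y; ring.
  rewrite cd2 sd2.
  transitivity (((2 * W - 1) ^+ 2 - 1) * (1 - (A * T ^+ 2 - B * Y ^+ 2))).
    by ring.
  congr (_ * _).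
  have -> : A * T ^+ 2 - B * Y ^+ 2 = (A * mu ^+ 2 - B * nu ^+ 2) * t ^+ 2
      - 2 * (A * (mu * nu) - B * (mu * nu)) * t * y
      + (A * nu ^+ 2 - B * mu ^+ 2) * y ^+ 2 by rewrite /T /Y; ring.
  by rewrite ctt cyy cty; ring.
Qed.

(** For large [r], put [t^2 = 1 + r^2] and solve [g t + k y = r] for [y]. A suitable [z] exists once
    [|y| <= r]; the upper bound on [y] is where [1 <= g + k] enters, as
    [r - g t <= (1 - g) r <= k r]. *)
Lemma conic_unbounded g k : 0 < g -> g < k -> 1 <= g + k -> forall K,
  exists t y z, [/\ 0 < t, K <= t, t ^+ 2 = 1 + y ^+ 2 + z ^+ 2 &
    t ^+ 2 - 1 = (g * t + k * y) ^+ 2].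
Proof.
move=> g0 gk gk1 K; have k0 : 0 < k by lra.
pose r := 1 + k + `|K|; have K0 := normr_ge0 K.
have r0 : 1 + k <= r by rewrite /r; lra.
have Kr : K <= r by rewrite /r; have := ler_norm K; lra.
clearbody r.
pose t := Num.sqrt (1 + r ^+ 2).
have t2 : t ^+ 2 = 1 + r ^+ 2 by rewrite sqr_sqrtr //; nra.
have t0 : 0 < t by rewrite sqrtr_gt0; nra.
have rt : r <= t by rewrite leNgt; apply/negP => h; nra.
have tr : t <= r + 1 by rewrite leNgt; apply/negP => h; nra.
pose y := (r - g * t) / k.
have yk : k * y = r - g * t by rewrite mulrC divfK ?gt_eqF.
clearbody t y.
have yr : y <= r by rewrite -(ler_pM2l k0) yk; nra.
have yr' : - r <= y by rewrite -(ler_pM2l k0) yk; nra.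
exists t, y, (Num.sqrt (r ^+ 2 - y ^+ 2)); split => //; first by lra.
  by rewrite sqr_sqrtr; nra.
by rewrite yk t2; ring.
Qed.
End PlaneConic.

(** * Compact and unbounded focus/directrix loci *)

Section FocusDirectrix.
Context {R : realType}.
Implicit Types (a x : H2 R) (l : set (H2 R)) (n : 'rV[R]_3) (eps : R).

(** Gram-Schmidt: [b] is the normalized component of [n] orthogonal to [a]. *)
Lemma orthonormal_frame a n : lorentz n n = 1 -> let j := lorentz n (set_val a) in
  exists b, [/\ lorentz b b = 1, lorentz (set_val a) b = 0
    & n = Num.sqrt (1 + j ^+ 2) *: b + (- j) *: set_val a].
Proof.
move=> nn j; pose r := Num.sqrt (1 + j ^+ 2).
have r2 : r ^+ 2 = 1 + j ^+ 2 by rewrite sqr_sqrtr //; have := sqr_ge0 j; lra.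
have r0 : r != 0 by apply/eqP => e; have := sqr_ge0 j; move: r2; rewrite e; lra.
exists (r^-1 *: (n + j *: set_val a)); split.
- rewrite !lorentzE nn lorentzxx (lorentzC _ n) -/j.
  by apply: (mulfI r0); apply: (mulfI r0); field: r2.
- by rewrite !lorentzE lorentzxx (lorentzC _ n) -/j; lra.
- by rewrite scalerA mulfV // scale1r scaleNr addrK.
Qed.

(** With [t = - <x, a>] and [y = <b, x>], one has [<n, x> = r y + j t], so [conic_foci] applies with
    [g = eps j], [k = eps r]. The two quadrics then differ by the nonzero factor [C^2 - 1]. *)
Lemma focus_directrix_is_two_focus a n eps :
    lorentz n n = 1 -> 0 < lorentz n (set_val a) -> 0 < eps ->
    eps * lorentz n (set_val a)
      + eps * Num.sqrt (1 + lorentz n (set_val a) ^+ 2) < 1 ->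
  exists f1 f2 c, hdist f1 f2 < c /\ forall x,
    lorentz (set_val x) (set_val a) ^+ 2 - 1 = (eps * lorentz n (set_val x)) ^+ 2
    <-> two_focus_locus f1 f2 c x.
Proof.
move=> nn j0 e0 small; have [b [bb ab nE]] := orthonormal_frame a n nn.
move: (lorentz n (set_val a)) j0 small nE => j j0 small nE.
set r := Num.sqrt (1 + j ^+ 2) in small nE.
have r2 : r ^+ 2 = 1 + j ^+ 2 by rewrite sqr_sqrtr //; nra.
have r0 : 0 < r by rewrite sqrtr_gt0; nra.
have [||||//|P [S [P' [S' [C [[P0 P0'] [PS PS'] PPC C1 quad]]]]]] :=
  conic_foci (eps * j) (eps * r) eps.
- exact: mulr_gt0.
- exact: mulr_gt0.
- by [].
- by rewrite !exprMn r2; ring.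
have aa := lorentzxx a; have ba : lorentz b (set_val a) = 0 by rewrite lorentzC.
have hf p s : 0 < p -> p ^+ 2 - s ^+ 2 = 1 ->
    hyperboloid R (p *: set_val a + s *: b).
  move=> p0 ps; apply: (hyperboloidP _ _ (H2P a)).
    by rewrite !lorentzE aa ab ba bb; lra.
  by rewrite !lorentzE aa ba; lra.
pose f1 := mkH2 _ (hf _ _ P0 PS); pose f2 := mkH2 _ (hf _ _ P0' PS').
have fc : hdist f1 f2 < arcosh C.
  rewrite ltNge; apply/negP => /(ler_cosh _ _ (arcosh_ge0 _ (ltW C1))).
  by rewrite cosh_hdist (arcoshK _ (ltW C1)) /= !lorentzE aa ab ba bb; lra.
exists f1, f2, (arcosh C); split => // x; rewrite two_focus_locusE // (arcoshK _ (ltW C1)).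
have -> : lorentz n (set_val x) = r * lorentz b (set_val x)
    + j * - lorentz (set_val x) (set_val a).
  by rewrite nE !lorentzE (lorentzC (set_val x)); ring.
rewrite /f1 /f2 /= !lorentzE (lorentzC (set_val x) b).
have := quad (- lorentz (set_val x) (set_val a)) (lorentz b (set_val x)).
move: (lorentz _ (set_val a)) (lorentz b _) => t y {}quad.
have C2 : C ^+ 2 - 1 != 0 by apply/eqP; nra.
split=> h.
  have z : 1 - (- t) ^+ 2 + (eps * j * - t + eps * r * y) ^+ 2 = 0 by lra.
  by rewrite z mulr0 in quad; lra.
have : (C ^+ 2 - 1) * (1 - (- t) ^+ 2 + (eps * j * - t + eps * r * y) ^+ 2) = 0.
  by rewrite -quad; lra.
by move/eqP; rewrite mulf_eq0 (negPf C2) /= => /eqP; lra.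
Qed.

Lemma focus_directrix_unbounded a n eps :
    lorentz n n = 1 -> 0 < lorentz n (set_val a) -> 0 < eps ->
    1 <= eps * lorentz n (set_val a)
      + eps * Num.sqrt (1 + lorentz n (set_val a) ^+ 2) ->
  forall K, exists x,
    lorentz (set_val x) (set_val a) ^+ 2 - 1 = (eps * lorentz n (set_val x)) ^+ 2
    /\ K <= - lorentz (set_val x) (set_val a).
Proof.
move=> nn j0 e0 large K; have [b [bb ab nE]] := orthonormal_frame a n nn.
move: (lorentz n (set_val a)) j0 large nE => j j0 large nE.
set r := Num.sqrt (1 + j ^+ 2) in large nE.
have r2 : r ^+ 2 = 1 + j ^+ 2 by rewrite sqr_sqrtr //; nra.
have r0 : 0 < r by rewrite sqrtr_gt0; nra.
have jr : j < r by rewrite ltNge; apply/negP => h; nra.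
have [|||t [y [z [t0 Kt t2 quad]]]] := conic_unbounded (eps * j) (eps * r) _ _ _ K.
- exact: mulr_gt0.
- by rewrite ltr_pM2l.
- by [].
have aa := lorentzxx a; have ba : lorentz b (set_val a) = 0 by rewrite lorentzC.
(* Completes [a], [b] to an orthonormal frame in which [(t, y, z)] are the coordinates of a
   point. *)
set d := cross (set_val a) b.
have dd : lorentz d d = 1 by rewrite lorentz_cross aa bb ab; lra.
have da : lorentz d (set_val a) = 0 by apply: lorentz_crossl.
have db : lorentz d b = 0 by apply: lorentz_crossr.
have ad : lorentz (set_val a) d = 0 by rewrite lorentzC.
have bd : lorentz b d = 0 by rewrite lorentzC.
have hx : hyperboloid R (t *: set_val a + y *: b + z *: d).
  apply: (hyperboloidP _ _ (H2P a)).
    by rewrite !lorentzE aa ab ba bb dd da db ad bd; lra.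
  by rewrite !lorentzE aa ba da; lra.
exists (mkH2 _ hx); rewrite /= nE !lorentzE aa ab ba bb da bd ad; split; last by lra.
transitivity (t ^+ 2 - 1); first by ring.
by rewrite quad; ring.
Qed.

(** The continuous function [<a, x>] would be bounded on a compact locus. *)
Lemma focus_directrix_noncompact a l n eps :
    lorentz n n = 1 -> (forall y, l y <-> lorentz n (set_val y) = 0) ->
    0 < lorentz n (set_val a) -> 0 < eps ->
    1 <= eps * lorentz n (set_val a)
      + eps * Num.sqrt (1 + lorentz n (set_val a) ^+ 2) ->
  ~ compact (focus_directrix_locus a l eps).
Proof.
move=> nn hl na e0 large cE.
pose f x := lorentz (set_val a) (set_val x).
have cf : continuous f.
  move=> x; apply: (@continuous_comp _ _ _ set_val (lorentz (set_val a))).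
    exact: initial_continuous.
  exact: continuous_lorentz.
have := @continuous_compact _ _ _ _ (continuous_subspaceT cf) cE.
move=> /compact_bounded[M [_ /(_ (M + 1))]].
have M1 : M < M + 1 by lra.
move=> /(_ M1) bnd.
have [x [/(focus_directrix_locusE _ _ _ _ _ nn hl e0) Ex]] :=
  focus_directrix_unbounded a n eps nn na e0 large (M + 2).
have := bnd (f x) (ex_intro2 _ _ x Ex erefl); rewrite /= /f lorentzC.
by move=> /ler_normlP[]; lra.
Qed.

(** The line is the slice where the third coordinate is 0, and the point [(sqrt 2, 0, 1)] lies off
    it. *)
Lemma exists_line_off : exists a l, is_line l /\ ~ l a.
Proof.
pose v (x y z : R) : 'rV[R]_3 :=
  \row_j (if j == 0 then x else if j == 1 then y else z).
have hg s : hyperboloid R (v (cosh s) (sinh s) 0).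
  rewrite /hyperboloid /= /lorentz !mxE /=.
  by have := cosh2B_sinh2 s; have := cosh_ge1 s; split; lra.
have s2 : Num.sqrt 2 ^+ 2 = 2 :> R by rewrite sqr_sqrtr.
have ha : hyperboloid R (v (Num.sqrt 2) 0 1).
  by rewrite /hyperboloid /= /lorentz !mxE /=; split; [lra | rewrite sqrtr_gt0].
exists (mkH2 _ ha), (range (fun s => mkH2 _ (hg s))); split.
  exists (fun s => mkH2 _ (hg s)); split => // s t.
  rewrite -coshK /hdist /= /lorentz !mxE /=; congr arcosh; rewrite coshB; ring.
case=> s _ /(congr1 (fun x : H2 R => set_val x 0 2)).
by rewrite /= !mxE /= => /esym/eqP; rewrite oner_eq0.
Qed.

End FocusDirectrix.

(** * Comparison of the two classes of ellipses *)

Theorem theorem13 (R : realType) :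
  [/\ focus_directrix_ellipses R <> two_focus_ellipses R,
      exists E : set (H2 R),
        focus_directrix_ellipses R E /\ two_focus_ellipses R E
    & forall E : set (H2 R),
        focus_directrix_ellipses R E -> compact E -> two_focus_ellipses R E].
Proof.
have small a l n eps : lorentz n n = 1 ->
    (forall y, l y <-> lorentz n (set_val y) = 0) ->
    0 < lorentz n (set_val a) -> 0 < eps ->
    eps * lorentz n (set_val a)
      + eps * Num.sqrt (1 + lorentz n (set_val a) ^+ 2) < 1 ->
    two_focus_ellipses R (focus_directrix_locus a l eps).
  move=> nn hl na e0 /(focus_directrix_is_two_focus a n eps nn na e0).
  move=> [f1 [f2 [c [fc fE]]]]; exists f1, f2, c; split => //.
  apply/seteqP; split=> x.
    by move=> /(focus_directrix_locusE _ _ _ _ _ nn hl e0)/fE.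
  by move=> /fE/(focus_directrix_locusE _ _ _ _ _ nn hl e0).
have [a [l [ll la]]] := @exists_line_off R.
have [n [nn hl na]] := line_normal_off l a ll la.
(* [r^-1] is the threshold eccentricity for this focus and directrix. At the threshold the locus is
   unbounded, which separates the classes; at half of it the locus belongs to both. *)
pose r := lorentz n (set_val a) + Num.sqrt (1 + lorentz n (set_val a) ^+ 2).
have r1 : 1 < r.
  suff : 1 <= Num.sqrt (1 + lorentz n (set_val a) ^+ 2) by rewrite /r; lra.
  rewrite -[X in X <= _]sqrtr1 ler_wsqrtr //.
  by have := sqr_ge0 (lorentz n (set_val a)); lra.
have r0 : r != 0 by rewrite gt_eqF; lra.
have rV0 : 0 < r^-1 by rewrite invr_gt0; lra.
have rV1 : r^-1 < 1 by rewrite invf_lt1; lra.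
split.
- move=> eqE.
  have large : 1 <= r^-1 * lorentz n (set_val a)
      + r^-1 * Num.sqrt (1 + lorentz n (set_val a) ^+ 2).
    by rewrite -mulrDr mulVf.
  have : focus_directrix_ellipses R (focus_directrix_locus a l r^-1).
    by exists a, l, r^-1; split => //; apply/andP.
  rewrite eqE => -[f1 [f2 [c [fc fE]]]].
  have [K bnd] := two_focus_locus_bounded a f1 f2 c.
  have [x [Ex Kx]] := focus_directrix_unbounded a n r^-1 nn na rV0 large (K + 1).
  have : focus_directrix_locus a l r^-1 x by apply/(focus_directrix_locusE _ _ _ _ _ nn hl).
  by rewrite fE => /bnd; lra.
- exists (focus_directrix_locus a l (r^-1 / 2)); split.
    by exists a, l, (r^-1 / 2); split => //; apply/andP; split; lra.
  apply: (small a l n) => //; first by lra.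
  by rewrite -mulrDr mulrAC mulVf //; lra.
- move=> E [a' [l' [eps [ll' la' /andP[e0 e1] ->]]]] cE.
  have [n' [nn' hl' na']] := line_normal_off l' a' ll' la'.
  apply: (small a' l' n') => //; rewrite ltNge; apply/negP => large.
  exact: (focus_directrix_noncompact a' l' n' eps nn' hl' na' e0 large cE).
Qed.
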